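(* Let $K$ be a field containing $\mathbb{Q}$ and $R=K[x_1,\ldots,x_n]$ the polynomial ring with $\deg x_i=1$. Let $m_1,\ldots,m_n$ and $d_{ij}$ ($1\le i\le n$, $1\le j\le m_i$) be positive integers, and let $I\subset R$ be the ideal generated by $$F_i=\prod_{j=1}^{m_i}L_{ij}^{d_{ij}}\quad (i=1,\ldots,n),\qquad L_{ij}=\xi_1^{(i,j)}x_1+\xi_2^{(i,j)}x_2+\cdots+\xi_n^{(i,j)}x_n,\ \ \xi_k^{(i,j)}\in K.$$ Assume the coefficients $\{\xi_k^{(i,j)} : 1\le i\le n,\ 1\le j\le m_i,\ 1\le k\le n\}$ are algebraically independent over $\mathbb{Q}$. Then (1) $I$ is an Artinian complete intersection ideal of $R$, and (2) $A=R/I$ has the strong Lefschetz property.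
   Context: A standard graded Artinian $K$-algebra is $A=\bigoplus_{i=0}^c A_i$ with $A_0=K$, generated by $A_1$, finite-dimensional, and $A_c\neq 0$. $A$ has the strong Lefschetz property (SLP) if there exists a linear form $z\in A_1$ such that the multiplication map $\times z^d: A_i\to A_{i+d}$ has full rank (i.e. is injective or surjective) for all $1\le d\le c-1$ and $0\le i\le c-d$; such $z$ is called a strong Lefschetz (SL) element. *)

(* Defs.v *)
From HB Require Import structures.
From mathcomp Require Import all_boot all_order all_algebra.
From mathcomp Require Import mpoly.
Set Implicit Arguments. Unset Strict Implicit. Unset Printing Implicit Defensive.
Import Order.TTheory GRing.Theory Num.Theory.
Local Open Scope ring_scope.

Section Defs.
Variables (K : fieldType) (n : nat).
Local Notation R := {mpoly K[n]}.

Definition ideal_gen (k : nat) (f : 'I_k -> R) (p : R) : Prop :=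
  exists g : 'I_k -> R, p = \sum_(j < k) g j * f j.

Definition ideal_prefix (k : nat) (f : 'I_k -> R) (i : nat) (p : R) : Prop :=
  exists g : 'I_k -> R, p = \sum_(j < k | (j < i)%N) g j * f j.

Definition regular_seq (k : nat) (f : 'I_k -> R) : Prop :=
  ~ ideal_gen f 1 /\
  forall (i : 'I_k) (g : R), ideal_prefix f i (g * f i) -> ideal_prefix f i g.

Definition complete_intersection (I : R -> Prop) : Prop :=
  exists (k : nat) (f : 'I_k -> R),
    regular_seq f /\ forall p, I p <-> ideal_gen f p.

(* R / I is finite-dimensional over K (I is Artinian): finitely many
   polynomials span R modulo I. *)
Definition artinian (I : R -> Prop) : Prop :=
  exists (N : nat) (s : 'I_N -> R),
    forall p : R, exists c : 'I_N -> K, I (p - \sum_(t < N) c t *: s t).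

(* For a homogeneous ideal I, the degree-i component A_i of A = R/I is
   nonzero. *)
Definition quot_comp_nonzero (I : R -> Prop) (i : nat) : Prop :=
  exists p : R, p \is i.-homog /\ ~ I p.

Definition top_degree (I : R -> Prop) (c : nat) : Prop :=
  quot_comp_nonzero I c /\ forall j, (c < j)%N -> ~ quot_comp_nonzero I j.

(* The multiplication map  x w : A_i -> A_(i+e)  (A = R/I, w a form) has full
   rank, i.e. is injective or surjective. *)
Definition mult_full_rank (I : R -> Prop) (w : R) (i e : nat) : Prop :=
  (forall p : R, p \is i.-homog -> I (w * p) -> I p) \/
  (forall q : R, q \is (i + e)%N.-homog ->
     exists p : R, p \is i.-homog /\ I (q - w * p)).

Definition SLP (I : R -> Prop) : Prop :=
  exists c : nat, top_degree I c /\
  exists z : R, z \is 1.-homog /\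
    forall e i : nat, (1 <= e)%N -> (e <= c - 1)%N -> (i <= c - e)%N ->
      mult_full_rank I (z ^+ e) i e.

End Defs.

(* Algebraic independence over Q of a finite family x : I -> K
   (K of characteristic 0, Q embedded via ratr). *)
Definition alg_indep_Q (K : fieldType) (I : finType) (x : I -> K) : Prop :=
  forall P : {mpoly rat[#|I|]}, P != 0 ->
    (map_mpoly (ratr : rat -> K) P).@[fun t => x (enum_val t)] != 0.

Definition linform (K : fieldType) (n : nat) (xi : 'I_n -> K) : {mpoly K[n]} :=
  \sum_(k < n) xi k *: 'X_k.

Definition Fgen (K : fieldType) (n : nat) (m : 'I_n -> nat)
  (d : forall i : 'I_n, 'I_(m i) -> nat)
  (xi : forall i : 'I_n, 'I_(m i) -> 'I_n -> K) (i : 'I_n) : {mpoly K[n]} :=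
  \prod_(j < m i) linform (xi i j) ^+ d i j.

(* Main.v *)
(** Specialising every L_ij to x_i turns F_i into x_i^{D_i}, where D_i is the sum
   of the d_ij, and by algebraic independence a matrix over Z[xi] has at the
   given coefficients at least the rank of any specialisation.  For each
   monomial m, write F^{m div D} x^{m mod D}; these products are the monomials
   themselves at the monomial point, hence in each degree they form a basis of
   R at the generic point as well.  Thus R is free over K[F_1, ..., F_n] on the
   monomials x^a with a_i < D_i, which makes F a regular sequence and R/(F)
   Artinian, with the Hilbert function of the monomial complete intersection.
   The strong Lefschetz property becomes freeness or spanning of the family made
   of the products z^e x^a (a reduced) and the F^{m div D} x^{m mod D} lying in
   the ideal, so it follows from the monomial case, with z = x_1 + ... + x_n.
   The monomial case is sl2-theory: the lowering operator is a differential
   operator on R preserving the ideal, and its commutator with z^k is a nonzero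
   scalar times z^{k-1} on the degrees that matter. *)

Require Import Defs.
From HB Require Import structures.
From mathcomp Require Import all_boot all_order all_algebra.
From mathcomp Require Import mpoly ssrcomplements.
From mathcomp Require Import ring zify bigenough.
Set Implicit Arguments. Unset Strict Implicit. Unset Printing Implicit Defensive.
Import Order.TTheory GRing.Theory Num.Theory BigEnough.
Local Open Scope ring_scope.

(** * Rank under specialisation *)

Lemma mxrank_mxsub (K : fieldType) (p q r s : nat) (A : 'M[K]_(p, q))
  (f : 'I_r -> 'I_p) (g : 'I_s -> 'I_q) : (\rank (mxsub f g A) <= \rank A)%N.
Proof.
have rowsub_le t u (B : 'M[K]_(t, u)) w (h : 'I_w -> 'I_t) :
  (\rank (rowsub h B) <= \rank B)%N by apply/mxrankS/rowsub_sub.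
rewrite mxsubrc; apply: leq_trans (rowsub_le _ _ _ _ _) _.
by rewrite -mxrank_tr trmx_mxsub -(mxrank_tr A) rowsub_le.
Qed.

(** Choose a maximal set of independent rows, then a maximal set of independent columns among these
    rows. *)
Lemma exists_unit_minor (K : fieldType) (p q : nat) (A : 'M[K]_(p, q)) :
  exists (f : 'I_(\rank A) -> 'I_p) (g : 'I_(\rank A) -> 'I_q),
    \det (mxsub f g A) != 0.
Proof.
have freeA : row_full (rowsub (maxrankfun A) A)^T.
  by rewrite /row_full mxrank_tr; exact: maxrowsub_free.
exists (maxrankfun A), (fullrankfun freeA); rewrite -unitfE -unitmxE.
have := fullrowsub_unit freeA.
by rewrite -trmx_mxsub unitmx_tr -mxsub_comp.
Qed.

(** A nonzero minor of maximal size at [psi] is the image of a determinant over [S]. If [phi] killed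
    this determinant, so would [psi]; hence the same minor is invertible at [phi]. *)
Lemma mxrank_specialization (S : comNzRingType) (K : fieldType)
  (phi psi : {rmorphism S -> K})
  (phi_psi : forall s, phi s = 0 -> psi s = 0) (p q : nat) (A : 'M[S]_(p, q)) :
  (\rank (map_mx psi A) <= \rank (map_mx phi A))%N.
Proof.
have [f [g det_fg]] := exists_unit_minor (map_mx psi A).
apply: leq_trans (mxrank_mxsub (map_mx phi A) f g).
rewrite eq_sym in det_fg; rewrite leq_eqVlt; apply/orP; left; rewrite eq_sym.
have : mxsub f g (map_mx phi A) \in unitmx.
  rewrite unitmxE unitfE -map_mxsub det_map_mx.
  apply: contra_neq det_fg => /phi_psi.
  by rewrite -det_map_mx map_mxsub.
by rewrite -row_free_unit.
Qed.

(** * Freeness and spanning of families of forms as rank conditions *)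

Section Families.
Variables (n : nat) (J : finType).

Definition mpoly_free (K : fieldType) (P : pred J) (v : J -> {mpoly K[n]}) :=
  forall c : J -> K, \sum_(j | P j) c j *: v j = 0 -> forall j, P j -> c j = 0.

Definition mpoly_spans (K : fieldType) (D : nat) (P : pred J)
    (v : J -> {mpoly K[n]}) :=
  forall p, p \is D.-homog -> exists c : J -> K, p = \sum_(j | P j) c j *: v j.

(** Columns are the monomials of degree exactly [D], so for forms of degree [D] freeness is full row
    rank and spanning is full column rank. The entries live in a ring [S], to be specialised
    entrywise. *)
Definition coef_mx (S : comNzRingType) (D : nat) (P : pred J)
    (v : J -> {mpoly S[n]}) :=
  \matrix_(r < #|P|, s < #|[pred m : 'X_{1..n < D.+1} | mdeg m == D]|)
     (v (enum_val r))@_(enum_val s).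

Lemma mul_coef_mx (K : fieldType) (D : nat) (P : pred J)
    (v : J -> {mpoly K[n]}) (c : J -> K) s :
  (\row_r c (enum_val r) *m coef_mx D P v) 0 s =
  (\sum_(j | P j) c j *: v j)@_(enum_val s).
Proof.
rewrite mxE raddf_sum /= [RHS](big_enum_val (A := P)).
by apply: eq_bigr => r _; rewrite !mxE mcoeffZ.
Qed.

Lemma enum_rowE (K : fieldType) (P : pred J) (u : 'rV[K]_#|P|) :
  exists c : J -> K, u = \row_r c (enum_val r).
Proof.
(* This sum is the extension of [u] by zero outside [P]. *)
exists (fun j => \sum_r (enum_val r == j)%:R * u 0 r).
apply/rowP => r; rewrite mxE (bigD1 r) //= eqxx mul1r big1 ?addr0 // => s.
by rewrite (inj_eq enum_val_inj) => /negPf->; rewrite mul0r.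
Qed.

Lemma homog_eq (K : fieldType) (D : nat) (p q : {mpoly K[n]}) :
  p \is D.-homog -> q \is D.-homog ->
  (forall s : 'I_#|[pred m : 'X_{1..n < D.+1} | mdeg m == D]|,
     p@_(enum_val s) = q@_(enum_val s)) -> p = q.
Proof.
move=> hp hq eq_pq; apply/mpolyP => m.
have [degm|ndegm] := eqVneq (mdeg m) D; last by rewrite !(dhomog_nemf_coeff _ ndegm).
have ltm : (mdeg m < D.+1)%N by rewrite degm.
have inP : BMultinom ltm \in [pred m : 'X_{1..n < D.+1} | mdeg m == D].
  by rewrite inE /= degm.
by have := eq_pq (enum_rank_in inP (BMultinom ltm)); rewrite enum_rankK_in.
Qed.

Lemma row_free_coef_mx (K : fieldType) (D : nat) (P : pred J)
    (v : J -> {mpoly K[n]}) (hv : forall j, P j -> v j \is D.-homog) :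
  row_free (coef_mx D P v) <-> mpoly_free P v.
Proof.
split=> [/row_freeP[B AB] c c0 j Pj | freev].
  have : \row_r c (enum_val r) *m coef_mx D P v = 0.
    by apply/rowP => s; rewrite mul_coef_mx c0 mcoeff0 mxE.
  move/(congr1 (mulmx^~ B)); rewrite -mulmxA AB mulmx1 mul0mx.
  move/rowP/(_ (enum_rank_in (A := P) Pj j)); rewrite !mxE enum_rankK_in //.
rewrite -kermx_eq0; apply/rowV0P => u /sub_kermxP.
have [c ->] := enum_rowE u => uA; apply/rowP => r; rewrite !mxE.
apply: freev; last exact: enum_valP.
apply: (@homog_eq _ D _ 0) => [||s]; rewrite ?rpred0 //.
  by rewrite rpred_sum // => j Pj; rewrite rpredZ ?hv.
by rewrite -mul_coef_mx uA mxE mcoeff0.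
Qed.

Lemma row_full_coef_mx (K : fieldType) (D : nat) (P : pred J)
    (v : J -> {mpoly K[n]}) (hv : forall j, P j -> v j \is D.-homog) :
  row_full (coef_mx D P v) <-> mpoly_spans D P v.
Proof.
have sum_homog c : \sum_(j | P j) c j *: v j \is D.-homog.
  by rewrite rpred_sum // => j Pj; rewrite rpredZ ?hv.
split=> [/row_fullP[B BA] p hp | spanv].
  have [c cE] := enum_rowE
    ((\row_(s < #|[pred m : 'X_{1..n < D.+1} | mdeg m == D]|) p@_(enum_val s)) *m B).
  exists c; apply: (homog_eq hp) => // s.
  by rewrite -mul_coef_mx -cE -mulmxA BA mulmx1 mxE.
rewrite -sub1mx; apply/row_subP => s.
have hX : 'X_[K, val (enum_val s)] \is D.-homog.
  by rewrite dhomogX; have := enum_valP s; rewrite inE.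
have [c cE] := spanv _ hX.
apply/submxP; exists (\row_r c (enum_val r)); apply/rowP => t.
rewrite mul_coef_mx -cE mcoeffX !mxE /=.
by rewrite -(inj_eq enum_val_inj) -(inj_eq val_inj).
Qed.

Variables (S : comNzRingType) (K : fieldType) (phi psi : {rmorphism S -> K}).
Hypothesis phi_psi : forall s, phi s = 0 -> psi s = 0.
Variables (D : nat) (P : pred J) (v : J -> {mpoly S[n]}).
Hypothesis hv : forall f : {rmorphism S -> K}, forall j, P j ->
  map_mpoly f (v j) \is D.-homog.

Variables v0 v1 : J -> {mpoly K[n]}.
Hypothesis v0E : forall j, map_mpoly psi (v j) = v0 j.
Hypothesis v1E : forall j, map_mpoly phi (v j) = v1 j.

Let coef_mx_eq (f : {rmorphism S -> K}) w :
  (forall j, map_mpoly f (v j) = w j) -> map_mx f (coef_mx D P v) = coef_mx D P w.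
Proof. by move=> fw; apply/matrixP => r s; rewrite !mxE -fw mcoeff_map_mpoly. Qed.

(** Freeness means that the rank equals the number of rows, its largest possible value, and the rank
    at [phi] is at least the rank at [psi]. *)
Lemma specialization_free : mpoly_free P v0 -> mpoly_free P v1.
Proof.
have h0 j : P j -> v0 j \is D.-homog by rewrite -v0E; apply: hv.
have h1 j : P j -> v1 j \is D.-homog by rewrite -v1E; apply: hv.
move=> /(row_free_coef_mx h0) fr; apply/(row_free_coef_mx h1); move: fr.
rewrite -(coef_mx_eq v0E) -(coef_mx_eq v1E) /row_free !eqn_leq !rank_leq_row /=.
by move=> /leq_trans; apply; apply: mxrank_specialization.
Qed.

Lemma specialization_spans : mpoly_spans D P v0 -> mpoly_spans D P v1.
Proof.
have h0 j : P j -> v0 j \is D.-homog by rewrite -v0E; apply: hv.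
have h1 j : P j -> v1 j \is D.-homog by rewrite -v1E; apply: hv.
move=> /(row_full_coef_mx h0) fr; apply/(row_full_coef_mx h1); move: fr.
rewrite -(coef_mx_eq v0E) -(coef_mx_eq v1E) /row_full !eqn_leq !rank_leq_col /=.
by move=> /leq_trans; apply; apply: mxrank_specialization.
Qed.

End Families.

(** * The monomial complete intersection *)

Lemma mcoeff_mulX (S : comNzRingType) (n : nat) (p : {mpoly S[n]}) k m :
  (p * 'X_[k])@_m = if (k <= m)%MM then p@_(m - k) else 0.
Proof.
case: ifP => [le_km|]; first by rewrite -[in LHS](submK le_km) addmC mcoeffMX.
move=> /negP nle_km; rewrite {1}(mpolyE p) mulr_suml raddf_sum /= big1 // => i _.
rewrite -scalerAl -mpolyXD mcoeffZ mcoeffX; case: eqP; last by rewrite mulr0.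
by move=> ikm; case: nle_km; rewrite -ikm lem_addl.
Qed.

Lemma mcoeff_mulX_mderiv (S : comNzRingType) (n : nat) (p : {mpoly S[n]}) i m :
  ('X_i * p^`M(i))@_m = p@_m *+ m i.
Proof.
rewrite mulrC mcoeff_mulX lep1mP; have [->|mi0] := eqVneq (m i) 0%N; first by [].
have le_im : (U_(i) <= m)%MM by rewrite lep1mP.
rewrite mcoeff_mderiv submK // mnmBE mnm1E eqxx subn1 prednK //.
by rewrite lt0n.
Qed.

Lemma euler_homog (S : comNzRingType) (n d : nat) (p : {mpoly S[n]}) :
  p \is d.-homog -> \sum_i 'X_i * p^`M(i) = d%:R *: p.
Proof.
move=> hp; apply/mpolyP => m; rewrite raddf_sum /= mcoeffZ.
under eq_bigr => i _ do rewrite mcoeff_mulX_mderiv -mulr_natl.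
rewrite -mulr_suml -natr_sum -mdegE.
have [-> //|ne] := eqVneq (mdeg m) d.
by rewrite (dhomog_nemf_coeff hp ne) !mulr0.
Qed.

Lemma homog_coeffP (S : comNzRingType) (n d : nat) (p : {mpoly S[n]}) :
  (forall m, mdeg m != d -> p@_m = 0) -> p \is d.-homog.
Proof.
move=> h; apply/dhomogP => m; rewrite mcoeff_msupp.
by apply: contra_neq_eq => /h.
Qed.

(** * Closure properties of the ideals generated by initial segments *)

Section PrefixIdeal.
Variables (K : fieldType) (n k : nat) (f : 'I_k -> {mpoly K[n]}) (i : nat).

Lemma ideal_prefixD p q :
  ideal_prefix f i p -> ideal_prefix f i q -> ideal_prefix f i (p + q).
Proof.
move=> [g ->] [h ->]; exists (fun j => g j + h j); rewrite -big_split /=.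
by apply: eq_bigr => j _; rewrite mulrDl.
Qed.

Lemma ideal_prefixM p q : ideal_prefix f i q -> ideal_prefix f i (p * q).
Proof.
move=> [g ->]; exists (fun j => p * g j); rewrite big_distrr /=.
by apply: eq_bigr => j _; rewrite mulrA.
Qed.

Lemma ideal_prefix0 : ideal_prefix f i 0.
Proof. by exists (fun=> 0); rewrite big1 // => j _; rewrite mul0r. Qed.

Lemma ideal_prefix_sum (T : eqType) (r : seq T) (F : T -> {mpoly K[n]}) :
  (forall x, x \in r -> ideal_prefix f i (F x)) ->
  ideal_prefix f i (\sum_(x <- r) F x).
Proof.
move=> h; rewrite big_seq.
by elim/big_ind: _ => //; [exact: ideal_prefix0 | exact: ideal_prefixD].
Qed.

Lemma ideal_prefix_mem (j : 'I_k) : (j < i)%N -> ideal_prefix f i (f j).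
Proof.
move=> ji; exists (fun l => (l == j)%:R).
rewrite (bigD1 j) //= eqxx mul1r big1 ?addr0 // => l /andP[_ /negPf->].
by rewrite mul0r.
Qed.

End PrefixIdeal.

Lemma ideal_gen_prefix (K : fieldType) (n k : nat) (f : 'I_k -> {mpoly K[n]}) p :
  ideal_gen f p <-> ideal_prefix f k p.
Proof.
by split=> -[g ->]; exists g; [apply: eq_big | apply: eq_big] => // j; rewrite ltn_ord.
Qed.

Section MonomialCI.
Variables (K : fieldType) (n : nat) (D : 'I_n -> nat).
Implicit Types (p q : {mpoly K[n]}) (m : 'X_{1..n}).

(** For [j = n], the monomials failing this test are the reduced ones: they form a basis of the
    monomial quotient. *)
Definition in_mono_prefix (j : nat) m :=
  [exists l : 'I_n, (l < j)%N && (D l <= m l)%N].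

(** Membership in the monomial ideal, phrased through coefficients so that operators can be checked
    one monomial at a time. *)
Definition mono_ideal (j : nat) p :=
  forall m, ~~ in_mono_prefix j m -> p@_m = 0.

Lemma mono_prefixP j p :
  ideal_prefix (fun i => 'X_i ^+ D i) j p <-> mono_ideal j p.
Proof.
split=> [[g ->] m|Ip].
  rewrite negb_exists => /forallP red; rewrite raddf_sum /= big1 // => l lj.
  rewrite mpolyXn mcoeff_mulX ifN //; apply/negP => /mnm_lepP /(_ l).
  rewrite mulmnE mnm1E eqxx mul1n => Dm.
  by have := red l; rewrite lj Dm.
rewrite (mpolyE p); apply: ideal_prefix_sum => m; rewrite mcoeff_msupp => pm.
have : in_mono_prefix j m by apply: contraNT pm => /Ip ->.
case/existsP => l /andP[lj Dm].
have le : (U_(l) *+ D l <= m)%MM.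
  apply/mnm_lepP => i; rewrite mulmnE mnm1E; case: eqP => [<-|_]; lia.
rewrite -(submK le) mpolyXD -mpolyXn scalerAl.
by apply/ideal_prefixM/(@ideal_prefix_mem _ _ _ (fun i : 'I_n => 'X_i ^+ D i)).
Qed.

Lemma mono_idealD j p q : mono_ideal j p -> mono_ideal j q -> mono_ideal j (p + q).
Proof. by move=> hp hq m mr; rewrite mcoeffD hp ?hq ?addr0. Qed.

Lemma mono_idealZ j a p : mono_ideal j p -> mono_ideal j (a *: p).
Proof. by move=> hp m mr; rewrite mcoeffZ hp ?mulr0. Qed.

Lemma mono_idealB j p q : mono_ideal j p -> mono_ideal j q -> mono_ideal j (p - q).
Proof. by move=> hp hq m mr; rewrite mcoeffB hp ?hq ?subr0. Qed.

Lemma mono_idealM j p q : mono_ideal j q -> mono_ideal j (p * q).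
Proof. by move=> /mono_prefixP hq; apply/mono_prefixP/ideal_prefixM. Qed.

Hypothesis D_pos : forall i, (0 < D i)%N.

Definition socle_degree := (\sum_i (D i).-1)%N.

Lemma reduced_mdeg m : ~~ in_mono_prefix n m -> (mdeg m <= socle_degree)%N.
Proof.
rewrite negb_exists mdegE => /forallP red; apply: leq_sum => i _.
by have := red i; have := D_pos i; rewrite ltn_ord /=; lia.
Qed.

(** * The sl2-action and the Lefschetz property of the monomial quotient *)

Definition sum_vars : {mpoly K[n]} := \sum_i 'X_i.

Lemma sum_vars_homog : sum_vars \is 1.-homog.
Proof. by rewrite rpred_sum // => i _; rewrite dhomogX; apply/eqP/mdeg1. Qed.

Lemma homog_sum_varsM e d p : p \is d.-homog -> sum_vars ^+ e * p \is (e + d).-homog.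
Proof.
by move=> hp; apply: dhomogM => //; have := dhomogMn e sum_vars_homog; rewrite mul1n.
Qed.

(* The lowering operator of the sl2-action on K[x]/(x_i^{D_i}) whose raising
   operator is multiplication by the sum of the variables: it sends x_i^a to
   a (D_i - a) x_i^(a-1), hence it is defined on all polynomials and preserves
   the ideal. *)
Definition lowering p : {mpoly K[n]} :=
  \sum_i ((D i).-1%:R *: p^`M(i) - 'X_i * p^`M(i)^`M(i)).

Lemma mcoeff_lowering p m :
  (lowering p)@_m =
  \sum_i p@_(m + U_(i)) * (((D i).-1%:R - (m i)%:R) * (m i).+1%:R).
Proof.
rewrite raddf_sum /=; apply: eq_bigr => i _.
rewrite mcoeffB mcoeffZ mcoeff_mulX_mderiv mcoeff_mderiv.
set x := p@_ _; rewrite -(mulr_natr (x *+ _)) -(mulr_natr x); ring.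
Qed.

Lemma loweringB p q : lowering (p - q) = lowering p - lowering q.
Proof.
apply/mpolyP => m; rewrite mcoeffB !mcoeff_lowering -sumrB.
by apply: eq_bigr => i _; rewrite mcoeffB mulrBl.
Qed.

(** A nonreduced monomial can be lowered to a reduced [x^m] only along an index [i] with
    [m i = D i - 1], and there the factor [D i - 1 - m i] vanishes. *)
Lemma lowering_mono_ideal p : mono_ideal n p -> mono_ideal n (lowering p).
Proof.
move=> hp m mr; rewrite mcoeff_lowering big1 // => i _.
have [|mi] := boolP (in_mono_prefix n (m + U_(i))%MM); last by rewrite hp ?mul0r.
case/existsP => l /andP[_]; rewrite mnmDE mnm1E => Dl.
move: mr; rewrite negb_exists => /forallP/(_ l); rewrite ltn_ord /= -ltnNge => ml.
have il : i = l by apply/eqP; case: eqP Dl => //; lia.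
rewrite il eqxx in Dl *.
have -> : (D l).-1 = m l by lia.
by rewrite subrr mul0r mulr0.
Qed.

Lemma lowering_homog d p : p \is d.+1.-homog -> lowering p \is d.-homog.
Proof.
move=> hp; apply: homog_coeffP => m md; rewrite mcoeff_lowering big1 // => i _.
by rewrite (dhomog_nemf_coeff hp) ?mul0r //= mdegD mdeg1 addn1 eqSS.
Qed.

Lemma lowering_const p : p \is 0.-homog -> lowering p = 0.
Proof.
move=> hp; apply/mpolyP => m; rewrite mcoeff_lowering big1 ?mcoeff0 // => i _.
by rewrite (dhomog_nemf_coeff hp) ?mul0r //= mdegD mdeg1 addn1.
Qed.

(** The sl2 commutation relation: the commutator acts on degree [d] by the weight
    [socle_degree - 2d]. *)
Lemma lowering_raising d p : p \is d.-homog ->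
  lowering (sum_vars * p) =
  sum_vars * lowering p + (socle_degree%:R - 2 * d%:R) *: p.
Proof.
move=> hp.
have dz i : sum_vars^`M(i) = 1.
  rewrite /sum_vars raddf_sum /= (bigD1 i) //= big1 => [|j ji].
    rewrite mderivX mnm1E eqxx scale1r addr0 -mpolyX0; congr mpolyX.
    by apply/mnmP => l; rewrite mnmBE subnn mnm0E.
  by rewrite mderivX mnm1E (negPf ji) scale0r.
have d1 i : (1 : {mpoly K[n]})^`M(i) = 0 by rewrite -mpolyC1 mderivC.
(* Euler's formula replaces [d p] by a sum over the variables, so that the identity can be checked
   for each variable separately. *)
rewrite scalerBl -scalerA -(euler_homog hp) /socle_degree natr_sum scaler_suml.
rewrite scaler_sumr big_distrr /= -sumrB -big_split /=; apply: eq_bigr => i _.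
rewrite !(mderivM, mderivD) !dz d1 !mul1r mul0r add0r -!mul_mpolyC !mpolyC_nat.
ring.
Qed.

(** The scalar is the sum of the weights [socle_degree - 2(d + j)] for [j] from 0 to [k]. *)
Lemma lowering_raisingX k d p : p \is d.-homog ->
  lowering (sum_vars ^+ k.+1 * p) = sum_vars ^+ k.+1 * lowering p +
    (k.+1%:R * (socle_degree%:R - 2 * d%:R - k%:R)) *: (sum_vars ^+ k * p).
Proof.
move=> hp; elim: k => [|k IHk].
  by rewrite !expr1 expr0 !mul1r subr0 (lowering_raising hp).
rewrite exprS -mulrA (lowering_raising (homog_sum_varsM k.+1 hp)) IHk.
rewrite -!mul_mpolyC !natrD !(rmorphM, rmorphB, rmorphD, rmorphMn, rmorph_nat) /=.
rewrite -!natr1 !exprS; ring.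
Qed.

Hypothesis charK : [pchar K] =i pred0.

Lemma natr_neq0 k : (0 < k)%N -> k%:R != 0 :> K.
Proof. by rewrite (pcharf0P K).1 // lt0n. Qed.

Lemma mono_idealZ_inv j a p : a != 0 -> mono_ideal j (a *: p) -> mono_ideal j p.
Proof. by move=> a0 /(mono_idealZ a^-1); rewrite scalerA mulVf // scale1r. Qed.

(** Lowering [z^(k+1) p] yields [z^(k+1) L p + a z^k p] in the ideal, with [a] nonzero by the degree
    bound. Once [L p] is in the ideal, by induction on the degree, so is [z^k p], and the exponent
    drops. *)
Lemma mono_lefschetz_inj d k p : p \is d.-homog -> (2 * d + k <= socle_degree)%N ->
  mono_ideal n (sum_vars ^+ k * p) -> mono_ideal n p.
Proof.
elim: d k p => [|d IHd] k p hp; elim: k => [|k IHk] le_c; rewrite ?mul1r //.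
  move=> Ip; apply: IHk; first by lia.
  have := lowering_mono_ideal Ip.
  rewrite (lowering_raisingX _ hp) lowering_const // mulr0 add0r.
  apply: mono_idealZ_inv; rewrite mulf_neq0 ?natr_neq0 //.
  by rewrite mulr0 subr0 -natrB ?natr_neq0; lia.
move=> Ip; apply: IHk; first by lia.
have := lowering_mono_ideal Ip; rewrite (lowering_raisingX _ hp).
set a := _ * (_ - _) => Ilow.
have a0 : a != 0.
  by rewrite mulf_neq0 ?natr_neq0 // -natrM -!natrB ?natr_neq0; lia.
(* Multiplying by [z] and subtracting [a z^(k+1) p] leaves [z^(k+2) L p]. The degree falls by one
   and the exponent rises by one, so the bound persists. *)
have Ilp : mono_ideal n (lowering p).
  apply: (IHd k.+2); [exact: lowering_homog | lia |].
  have := mono_idealB (mono_idealM sum_vars Ilow) (mono_idealZ a Ip).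
  by rewrite mulrDr !exprS -!mulrA -scalerAr addrK.
apply: mono_idealZ_inv a0 _.
by have := mono_idealB Ilow (mono_idealM (sum_vars ^+ k.+1) Ilp); rewrite addrC addKr.
Qed.

(** Descending induction on [d], measured by [t], and inner induction on [k]. In the quotient,
    [q = z^k u] by the inner hypothesis and [z q = z^(k+2) w] by the outer one; lowering
    [z^(k+1) u - z^(k+2) w] then makes [z^k u] divisible by [z^(k+1)]. *)
Lemma mono_lefschetz_surj d k q : q \is d.-homog -> (socle_degree + k <= 2 * d)%N ->
  exists p, p \is (d - k).-homog /\ mono_ideal n (q - sum_vars ^+ k * p).
Proof.
have [t le_t] : exists t, (socle_degree < d + t)%N by exists socle_degree.+1; lia.
(* Above the socle degree every form lies in the ideal, so 0 is a preimage. *)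
have big_deg e r l : r \is e.-homog -> (socle_degree < e)%N ->
    exists p, p \is (e - l).-homog /\ mono_ideal n (r - sum_vars ^+ l * p).
  move=> hr lt_e; exists 0; rewrite rpred0; split=> // m /reduced_mdeg le_m.
  rewrite mulr0 subr0 (dhomog_nemf_coeff hr) //=; lia.
elim: t d k q le_t => [|t IHt] d k q le_t hq; first by move=> _; apply: big_deg hq _; lia.
elim: k => [|k IHk] le_c.
  by exists q; rewrite subn0 mul1r subrr; split=> // m _; rewrite mcoeff0.
(* With [d] at most the socle degree, [le_c] forces [k + 1 <= d], so the subtractions [d - k] and
   [d - k.+1] are not truncated. *)
have [lt_d|le_d] := ltnP socle_degree d; first exact: big_deg hq lt_d.
have [|u [hu Iu]] := IHk; first by lia.
have [||| w [hw Iw]] := IHt d.+1 k.+2 (sum_vars * q); try lia.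
  by have := homog_sum_varsM 1 hq.
have dE : (d - k = (d - k.+1).+1)%N by lia.
rewrite subSS in hw.
have := lowering_mono_ideal (mono_idealB Iw (mono_idealM sum_vars Iu)).
rewrite (_ : _ - _ = sum_vars ^+ k.+1 * u - sum_vars ^+ k.+2 * w).
  2: by rewrite !exprS; ring.
rewrite loweringB.
rewrite (lowering_raisingX _ hu) (lowering_raisingX _ hw).
set a := _ * (_ - _); set b := _ * (_ - _) => Iab.
have a0 : a != 0.
  rewrite mulf_neq0 ?natr_neq0 //.
  rewrite (_ : _ - _ = - (2 * d - socle_degree - k)%:R); last first.
    by rewrite !natrB ?natrM ?natrB; try lia; ring.
  by rewrite oppr_eq0 natr_neq0; lia.
(* The witness solves [Iab] for [z^k u], which is congruent to [q]. *)
exists (a^-1 *: (sum_vars * lowering w + b *: w - lowering u)); split.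
  rewrite dE in hu; have := lowering_homog hu => hlu.
  rewrite rpredZ // rpredB ?rpredD ?rpredZ //.
  case: (d - k.+1)%N hw => [|e] hw; first by rewrite lowering_const ?mulr0 ?rpred0.
  exact: homog_sum_varsM 1 _ _ (lowering_homog hw).
have := mono_idealD Iu (mono_idealZ a^-1 Iab).
rewrite scalerBr scalerDr scalerA mulVf // scale1r !scalerDr; congr mono_ideal.
rewrite -!mul_mpolyC !exprS; ring.
Qed.
End MonomialCI.

(** * The power basis *)

Lemma homog_expand (S : comNzRingType) (n d k : nat) (p : {mpoly S[n]}) :
  p \is d.-homog -> (d < k)%N ->
  p = \sum_(m : 'X_{1..n < k} | mdeg m == d) p@_m *: 'X_[m].
Proof.
move=> hp lt_dk; rewrite -{1}(pihomog_dE hp) (pihomogwE _ _ (k := k)) //.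
by apply: leq_trans lt_dk; rewrite msizeE; apply/bigmax_leqP_seq => m /(dhomog_mf hp) /= ->.
Qed.

Lemma mcoeff_sumX (S : comNzRingType) (n k : nat) (P : pred 'X_{1..n < k})
    (c : 'X_{1..n < k} -> S) (j : 'X_{1..n < k}) :
  (\sum_(i | P i) c i *: 'X_[i])@_j = if P j then c j else 0.
Proof.
rewrite raddf_sum /= (eq_bigr (fun i => if i == j then c i else 0)) => [|i _].
  rewrite -big_mkcondr big_mkcond /= (bigD1 j) //= eqxx andbT big1 ?addr0 //.
  by move=> i /negPf->; rewrite andbF.
by rewrite mcoeffZ mcoeffX -bmeqP; case: eqP => _; rewrite ?mulr1 ?mulr0.
Qed.

Lemma dhomog_bigprod (S : comNzRingType) (n k : nat) (f : 'I_k -> {mpoly S[n]})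
    (d : 'I_k -> nat) : (forall i, f i \is (d i).-homog) ->
  \prod_i f i \is (\sum_i d i)%N.-homog.
Proof.
move=> hf; elim/big_rec2: _ => [|i e p _ he]; first exact: dhomog1.
exact: dhomogM.
Qed.

Section PowerBasis.
Variables (S : comNzRingType) (n : nat) (D : 'I_n -> nat).
Hypothesis D_pos : forall i, (0 < D i)%N.
Implicit Types (F : 'I_n -> {mpoly S[n]}) (m : 'X_{1..n}).

Definition mnm_mod (m : 'X_{1..n}) := [multinom m i %% D i | i < n].

Definition power_basis F m : {mpoly S[n]} :=
  (\prod_i F i ^+ (m i %/ D i)) * 'X_[mnm_mod m].

Lemma eq_power_basis F G : F =1 G -> power_basis F =1 power_basis G.
Proof. by move=> FG m; congr (_ * _); apply: eq_bigr => i _; rewrite FG. Qed.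

Lemma power_basis_mono m : power_basis (fun i => 'X_i ^+ D i) m = 'X_[m].
Proof.
rewrite /power_basis [in RHS]mpolyXE_id [X in _ * X]mpolyXE_id -big_split /=.
by apply: eq_bigr => i _; rewrite mnmE -exprM -exprD mulnC -divn_eq.
Qed.

Lemma power_basis_reduced F m :
  ~~ in_mono_prefix D n m -> power_basis F m = 'X_[m].
Proof.
rewrite negb_exists => /forallP red.
have lt_mD i : (m i < D i)%N by have := red i; rewrite ltn_ord /= -ltnNge.
rewrite /power_basis big1 ?mul1r => [|i _]; last by rewrite divn_small.
by congr mpolyX; apply/mnmP => i; rewrite mnmE modn_small.
Qed.

(** Only the [i]-th quotient changes, by one, and no remainder does. Hence multiplication by
    [x_i^(D i)] on exponents corresponds to multiplication by [F i]. *)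
Lemma power_basis_shift F i m :
  power_basis F (m + U_(i) *+ D i) = F i * power_basis F m.
Proof.
rewrite /power_basis; have -> : mnm_mod (m + U_(i) *+ D i) = mnm_mod m.
  apply/mnmP => j; rewrite !mnmE mulmnE mnm1E.
  by case: eqP => [->|_]; rewrite ?mul1n ?modnDr ?mul0n ?addn0.
rewrite mulrA; congr (_ * _); rewrite (bigD1 i) //= [in RHS](bigD1 i) //= mulrA.
rewrite -exprS mnmDE mulmnE mnm1E eqxx mul1n divnDr ?dvdnn // divnn D_pos addn1.
congr (_ * _); apply: eq_bigr => j /negPf ji.
by rewrite mnmDE mulmnE mnm1E eq_sym ji mul0n addn0.
Qed.

Lemma power_basis_homog F m : (forall i, F i \is (D i).-homog) ->
  power_basis F m \is (mdeg m).-homog.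
Proof.
move=> hF; have -> : mdeg m = (\sum_i D i * (m i %/ D i) + mdeg (mnm_mod m))%N.
  rewrite !mdegE -big_split /=; apply: eq_bigr => i _.
  by rewrite mnmE mulnC -divn_eq.
apply: dhomogM; last by rewrite dhomogX.
by apply: dhomog_bigprod => i; apply: dhomogMn.
Qed.

Definition lefschetz_family F e m :=
  if in_mono_prefix D n m then power_basis F m
  else (\sum_i 'X_i) ^+ e * 'X_[m].

(** Reduced monomials are taken in degree [i], since they get multiplied by [z^e], and nonreduced
    ones in degree [i + e]; all members then have degree [i + e]. *)
Definition lefschetz_index i e (m : 'X_{1..n < (i + e).+1}) :=
  mdeg m == if in_mono_prefix D n m then (i + e)%N else i.

End PowerBasis.

Lemma map_power_basis (S T : comNzRingType) (f : {rmorphism S -> T}) (n : nat)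
    (D : 'I_n -> nat) (F : 'I_n -> {mpoly S[n]}) m :
  map_mpoly f (power_basis D F m) = power_basis D (fun i => map_mpoly f (F i)) m.
Proof.
rewrite rmorphM rmorph_prod /= map_mpolyX; congr (_ * _).
by apply: eq_bigr => i _; rewrite rmorphXn.
Qed.

Lemma map_lefschetz_family (S T : comNzRingType) (f : {rmorphism S -> T}) (n : nat)
    (D : 'I_n -> nat) (F : 'I_n -> {mpoly S[n]}) e m :
  map_mpoly f (lefschetz_family D F e m) =
  lefschetz_family D (fun i => map_mpoly f (F i)) e m.
Proof.
rewrite /lefschetz_family; case: ifP => _; first exact: map_power_basis.
rewrite rmorphM rmorphXn raddf_sum /= map_mpolyX; congr (_ ^+ _ * _).
by apply: eq_bigr => i _; rewrite map_mpolyX.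
Qed.

Lemma lefschetz_family_homog (K : fieldType) (n : nat) (D : 'I_n -> nat)
    (F : 'I_n -> {mpoly K[n]}) i e (m : 'X_{1..n < (i + e).+1}) :
  (forall i, F i \is (D i).-homog) -> lefschetz_index D m ->
  lefschetz_family D F e m \is (i + e)%N.-homog.
Proof.
rewrite /lefschetz_index /lefschetz_family => hF; case: ifP => _ /eqP dm.
  by have := power_basis_homog m hF; rewrite dm.
have hX : 'X_[K, m] \is i.-homog by rewrite dhomogX /= dm.
by have := homog_sum_varsM e hX; rewrite [(e + i)%N]addnC.
Qed.

(** * The power basis and the Lefschetz family at the monomial point *)

Section MonomialFamily.
Variables (K : fieldType) (n : nat) (D : 'I_n -> nat).
Hypothesis D_pos : forall i, (0 < D i)%N.
Hypothesis charK : [pchar K] =i pred0.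
Let F (i : 'I_n) : {mpoly K[n]} := 'X_i ^+ D i.

Lemma mono_power_basis_free d :
  mpoly_free (fun m : 'X_{1..n < d.+1} => mdeg m == d)
    (fun m => power_basis D F m).
Proof.
move=> c; rewrite (eq_bigr (fun m : 'X_{1..n < d.+1} => c m *: 'X_[m])) => [c0 j dj|m _].
  by have := mcoeff_sumX (fun m : 'X_{1..n < d.+1} => mdeg m == d) c j; rewrite c0 dj mcoeff0.
by rewrite power_basis_mono.
Qed.

Lemma mono_power_basis_spans d :
  mpoly_spans d (fun m : 'X_{1..n < d.+1} => mdeg m == d)
    (fun m => power_basis D F m).
Proof.
move=> p hp; exists (fun m : 'X_{1..n < d.+1} => p@_m); rewrite {1}(homog_expand hp (ltnSn d)).
by apply: eq_bigr => m _; rewrite power_basis_mono.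
Qed.

Lemma mono_ideal_sumX k (P : pred 'X_{1..n < k}) c :
  (forall m : 'X_{1..n < k}, P m -> in_mono_prefix D n m) ->
  mono_ideal D n (\sum_(m | P m) c m *: 'X_[m] : {mpoly K[n]}).
Proof.
move=> hP m mr; rewrite raddf_sum /= big1 // => l /hP.
by rewrite mcoeffZ mcoeffX; case: eqP => [->|_ _]; rewrite ?mulr0 // (negPf mr).
Qed.

(** Separates a combination into its ideal part and [z^e] times a reduced form of degree [i]. *)
Lemma lefschetz_family_sum (G : 'I_n -> {mpoly K[n]}) i e c :
  \sum_(m | lefschetz_index D m) c m *: lefschetz_family D G e (bmnm m) =
  \sum_(m : 'X_{1..n < (i + e).+1} | (mdeg m == i + e)%N && in_mono_prefix D n m)
     c m *: power_basis D G m +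
  sum_vars K n ^+ e *
  \sum_(m : 'X_{1..n < (i + e).+1} | (mdeg m == i) && ~~ in_mono_prefix D n m)
     c m *: 'X_[m].
Proof.
rewrite (bigID (fun m : 'X_{1..n < (i + e).+1} => in_mono_prefix D n m)) /=; congr (_ + _).
  apply: eq_big => m; rewrite /lefschetz_index /lefschetz_family.
    by case: ifP; rewrite ?andbF.
  by case/andP=> _ ->.
rewrite big_distrr /=; apply: eq_big => m; rewrite /lefschetz_index /lefschetz_family.
  by case: ifP; rewrite ?andbF.
by case/andP=> _ /negPf ->; rewrite scalerAr.
Qed.

(** In a relation [q + z^e p = 0] with [q] in the ideal, injectivity puts [p] in the ideal; being
    reduced, [p] is 0, and then so is [q]. *)
Lemma mono_lefschetz_family_free i e : (2 * i + e <= socle_degree D)%N ->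
  mpoly_free (@lefschetz_index n D i e) (fun m => lefschetz_family D F e (bmnm m)).
Proof.
move=> le_c c; rewrite lefschetz_family_sum.
under eq_bigr => m _ do rewrite power_basis_mono.
set q := \sum_(m | _) _; set p := \sum_(m | _) _ => qp0.
have Iq : mono_ideal D n q by apply: mono_ideal_sumX => m /andP[].
have hp : p \is i.-homog.
  by rewrite rpred_sum // => m /andP[/eqP dm _]; rewrite rpredZ // dhomogX /= dm.
have Ip : mono_ideal D n p.
  apply: (mono_lefschetz_inj charK hp le_c).
  have -> : sum_vars K n ^+ e * p = 0 - q by rewrite -qp0 addrC addKr.
  by apply: mono_idealB => // m _; rewrite mcoeff0.
move=> j; rewrite /lefschetz_index; case: ifPn => [jN dj|jR dj].
  have p0 : p = 0.
    apply: big1 => m /andP[dm mr]; have := Ip m mr.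
    by rewrite mcoeff_sumX dm mr /= => ->; rewrite scale0r.
  move: qp0; rewrite p0 mulr0 addr0 => /(congr1 (mcoeff j)).
  by rewrite mcoeff_sumX dj jN mcoeff0.
by have := Ip j jR; rewrite mcoeff_sumX dj jR.
Qed.

Lemma mono_lefschetz_family_spans i e : (socle_degree D <= 2 * i + e)%N ->
  mpoly_spans (i + e) (@lefschetz_index n D i e)
    (fun m => lefschetz_family D F e (bmnm m)).
Proof.
move=> le_c q hq.
have [|p [hp Iqp]] := mono_lefschetz_surj D_pos charK (k := e) hq; first by lia.
rewrite addnK in hp.
(* Replacing the preimage [p] by its reduced part changes [z^e p] only by an element of the
   ideal. *)
pose r : {mpoly K[n]} := \sum_(m : 'X_{1..n < (i + e).+1} |
  (mdeg m == i) && ~~ in_mono_prefix D n m) p@_m *: 'X_[m].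
have Iqr : mono_ideal D n (q - sum_vars K n ^+ e * r).
  have -> : q - sum_vars K n ^+ e * r =
    (q - sum_vars K n ^+ e * p) + sum_vars K n ^+ e * (p - r) by ring.
  apply: mono_idealD Iqp _; apply: mono_idealM.
  have lt_i : (i < (i + e).+1)%N by lia.
  rewrite {1}(homog_expand hp lt_i) /r.
  rewrite (bigID (fun m : 'X_{1..n < (i + e).+1} => in_mono_prefix D n m)) /= addrK.
  by apply: mono_ideal_sumX => m /andP[].
exists (fun m : 'X_{1..n < (i + e).+1} =>
  if in_mono_prefix D n m then (q - sum_vars K n ^+ e * r)@_m else p@_m).
rewrite lefschetz_family_sum.
have hr : r \is i.-homog.
  by rewrite rpred_sum // => m /andP[/eqP dm _]; rewrite rpredZ // dhomogX /= dm.
have hqr : q - sum_vars K n ^+ e * r \is (i + e)%N.-homog.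
  by rewrite rpredB // addnC homog_sum_varsM.
rewrite -[LHS](subrK (sum_vars K n ^+ e * r)); congr (_ + _ * _).
  rewrite [LHS](homog_expand hqr (ltnSn _)).
  rewrite (bigID (fun m : 'X_{1..n < (i + e).+1} => in_mono_prefix D n m)) /=.
  rewrite [X in _ + X]big1 ?addr0 => [|m /andP[_ /Iqr->]]; last by rewrite scale0r.
  by apply: eq_bigr => m /andP[_ ->]; rewrite power_basis_mono.
by apply: eq_bigr => m /andP[_ /negPf->].
Qed.

End MonomialFamily.

(** * Transfer from the monomial complete intersection *)

Section Transfer.
Variables (K : fieldType) (n : nat) (D : 'I_n -> nat).
Hypothesis D_pos : forall i, (0 < D i)%N.
Variable F : 'I_n -> {mpoly K[n]}.
Hypothesis hF : forall i, F i \is (D i).-homog.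
Hypothesis basis_free : forall d,
  mpoly_free (fun m : 'X_{1..n < d.+1} => mdeg m == d)
    (fun m => power_basis D F m).
Hypothesis basis_spans : forall d,
  mpoly_spans d (fun m : 'X_{1..n < d.+1} => mdeg m == d)
    (fun m => power_basis D F m).

(* By freeness of R over K[F_1, ..., F_n], this K-linear bijection identifies
   the monomial complete intersection with the one defined by F. *)
Definition basis_map (q : {mpoly K[n]}) : {mpoly K[n]} :=
  \sum_(m <- msupp q) q@_m *: power_basis D F m.

Lemma basis_mapE k q : (msize q <= k)%N ->
  basis_map q = \sum_(m : 'X_{1..n < k}) q@_m *: power_basis D F m.
Proof.
move=> le_qk; rewrite /basis_map (big_mksub 'X_{1..n < k}) ?msupp_uniq //=; last first.
  by move=> m /msize_mdeg_lt /leq_trans; apply.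
by rewrite big_rmcond //= => m /memN_msupp_eq0 ->; rewrite scale0r.
Qed.

Lemma basis_map_is_linear : linear basis_map.
Proof.
move=> c p q; pose_big_enough k.
  rewrite !(basis_mapE (k := k)) // scaler_sumr -big_split /=.
  by apply: eq_bigr => m _; rewrite mcoeffD mcoeffZ scalerDl scalerA.
by close.
Qed.

HB.instance Definition _ :=
  GRing.isLinear.Build K {mpoly K[n]} {mpoly K[n]} _ basis_map basis_map_is_linear.

Lemma basis_mapX m : basis_map 'X_[m] = power_basis D F m.
Proof. by rewrite /basis_map msuppX big_seq1 mcoeffX eqxx scale1r. Qed.

Lemma basis_map_sumX k (P : pred 'X_{1..n < k}) c :
  basis_map (\sum_(m | P m) c m *: 'X_[m]) =
  \sum_(m | P m) c m *: power_basis D F (bmnm m).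
Proof. by rewrite linear_sum; apply: eq_bigr => m _; rewrite linearZ /= basis_mapX. Qed.

Lemma basis_map_shift i q : basis_map (q * 'X_i ^+ D i) = basis_map q * F i.
Proof.
rewrite [in LHS](mpolyE q) [in RHS](mpolyE q) mulr_suml !linear_sum mulr_suml /=.
apply: eq_bigr => m _; rewrite -scalerAl !linearZ /= mpolyXn -mpolyXD !basis_mapX.
by rewrite power_basis_shift // -scalerAl mulrC.
Qed.

(** Freeness is available one degree at a time; [basis_map] preserves degrees, so it commutes with
    taking homogeneous components. *)
Lemma basis_map_inj q : basis_map q = 0 -> q = 0.
Proof.
move=> q0; apply/mpolyP => m; rewrite mcoeff0.
pose d := mdeg m; pose r := pihomog mdeg d q.
have hr : r \is d.-homog by apply: pihomogP.
have r0 : basis_map r = 0.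
  have -> : basis_map r = pihomog mdeg d (basis_map q).
    rewrite /r pihomogE [basis_map q]/basis_map !linear_sum /= big_mkcond /=.
    apply: eq_bigr => l _; rewrite !linearZ /= !basis_mapX.
    have hl : power_basis D F l \is (mdeg l).-homog by apply: power_basis_homog.
    case: eqP => [<-|/eqP ne]; first by rewrite pihomog_dE.
    by rewrite (pihomog_ne0 ne hl) scaler0.
  by rewrite q0 raddf0.
have lt_m : (mdeg m < d.+1)%N by [].
have -> : q@_m = r@_m.
  rewrite {1}(@pihomog_partitionE _ _ mdeg (maxn (msize q) d.+1) q (leq_maxl _ _)).
  have lt_d : (d < maxn (msize q) d.+1)%N by rewrite leq_maxr.
  rewrite raddf_sum /= (bigD1 (Ordinal lt_d)) //= big1 ?addr0 // => e /eqP ne.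
  rewrite (dhomog_nemf_coeff (pihomogP _ _ _)) //.
  by apply/negP => /eqP de; apply: ne; apply: val_inj.
move: r0; rewrite (homog_expand hr (ltnSn d)) basis_map_sumX => /basis_free/(_ (BMultinom lt_m)).
move=> rm; rewrite -(homog_expand hr (ltnSn d)); exact: rm.
Qed.

Lemma basis_map_homog_surj d p : p \is d.-homog ->
  exists2 q, q \is d.-homog & p = basis_map q.
Proof.
move=> /basis_spans[c ->]; exists (\sum_(m : 'X_{1..n < d.+1} | mdeg m == d) c m *: 'X_[m]).
  by rewrite rpred_sum // => m dm; rewrite rpredZ // dhomogX.
by rewrite basis_map_sumX.
Qed.

Lemma basis_map_surj p : exists q, p = basis_map q.
Proof.
rewrite (pihomog_partitionE (mf := mdeg) (leqnn (msize p))).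
elim/big_ind: _ => [|_ _ [q ->] [r ->]|d _].
- by exists 0; rewrite linear0.
- by exists (q + r); rewrite linearD.
by have [q _ ->] := basis_map_homog_surj (pihomogP mdeg d p); exists q.
Qed.

(** Cofactors are carried across by [basis_map_shift]: surjectivity lifts those of [F], and
    injectivity cancels [basis_map]. All prefixes are covered, as regularity requires. *)
Lemma basis_map_prefix j q : ideal_prefix F j (basis_map q) <-> mono_ideal D j q.
Proof.
split=> [[g gE]|/mono_prefixP[g ->]].
  have [h hE] : exists h, forall l, g l = basis_map (h l).
    have [h hE] := fin_all_exists (fun l => basis_map_surj (g l)).
    by exists h.
  apply/mono_prefixP; exists h; apply/eqP; rewrite -subr_eq0; apply/eqP.
  apply: basis_map_inj; rewrite linearB /= gE [basis_map _]linear_sum -sumrB big1 // => l _.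
  by rewrite /= basis_map_shift hE subrr.
exists (fun l => basis_map (g l)); rewrite linear_sum.
by apply: eq_bigr => l _; rewrite /= basis_map_shift.
Qed.

Lemma basis_map_ideal q : ideal_gen F (basis_map q) <-> mono_ideal D n q.
Proof. by split=> [/ideal_gen_prefix/basis_map_prefix|/basis_map_prefix/ideal_gen_prefix]. Qed.

Lemma ideal_reduced m : ~~ in_mono_prefix D n m -> ~ ideal_gen F 'X_[m].
Proof.
move=> mr; rewrite -(power_basis_reduced F mr) -basis_mapX => /basis_map_ideal/(_ m mr).
by move/eqP; rewrite mcoeffX eqxx oner_eq0.
Qed.

Lemma reduced0 : ~~ in_mono_prefix D n 0%MM.
Proof.
by rewrite negb_exists; apply/forallP => i; rewrite mnm0E ltn_ord /= -ltnNge D_pos.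
Qed.

(** Pulled back along [basis_map], regularity says that adding [D i] to the exponent of [x_i] does
    not affect divisibility by [x_l^(D l)] for [l < i]. *)
Lemma power_regular : regular_seq F.
Proof.
split; first by rewrite -mpolyX0; apply: ideal_reduced reduced0.
move=> i g; have [h ->] := basis_map_surj g; rewrite -basis_map_shift.
rewrite !basis_map_prefix => Ih m mr.
have : ~~ in_mono_prefix D i (m + U_(i) *+ D i).
  move: mr; rewrite !negb_exists => /forallP mr; apply/forallP => l.
  rewrite mnmDE mulmnE mnm1E; have := mr l.
  by case: eqP => [->|_]; rewrite ?ltnn // mul0n addn0.
by move/Ih; rewrite mpolyXn mcoeff_mulX lem_addl addmK.
Qed.

Lemma power_artinian : artinian (ideal_gen F).
Proof.
pose T : finType := 'X_{1..n < (socle_degree D).+1}.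
exists #|T|, (fun t : 'I_#|T| => 'X_[bmnm (enum_val t)]) => p; have [q ->] := basis_map_surj p.
(* The nonreduced part of [q] is dropped because its image lies in the ideal; [basis_map] fixes the
   reduced monomials that remain. *)
pose c (m : T) := if in_mono_prefix D n m then 0 else q@_m.
exists (fun t => c (enum_val t)).
have -> : \sum_(t < #|T|) c (enum_val t) *: 'X_[bmnm (enum_val t)] =
          basis_map (\sum_(m : T) c m *: 'X_[m]).
  rewrite basis_map_sumX [RHS](big_enum_val (A := T)) /=; apply: eq_bigr => t _.
  rewrite /c; case: ifPn => [_|mr]; first by rewrite !scale0r.
  by rewrite power_basis_reduced.
rewrite -linearB; apply/basis_map_ideal => m mr.
have lt_m : (mdeg m < (socle_degree D).+1)%N by rewrite ltnS reduced_mdeg.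
by rewrite mcoeffB (mcoeff_sumX xpredT c (BMultinom lt_m)) /c (negPf mr) subrr.
Qed.

Lemma power_top_degree : top_degree (ideal_gen F) (socle_degree D).
Proof.
split.
  exists 'X_[[multinom (D i).-1 | i < n]]; split.
    by rewrite dhomogX; apply/eqP; rewrite /= mdegE; apply: eq_bigr => i _; rewrite mnmE.
  apply: ideal_reduced; rewrite negb_exists; apply/forallP => i.
  by rewrite mnmE ltn_ord /= -ltnNge prednK.
move=> j lt_j [p [hp]]; apply.
have [q hq ->] := basis_map_homog_surj hp; apply/basis_map_ideal => m /(reduced_mdeg D_pos) le_m.
by rewrite (dhomog_nemf_coeff hq) // neq_ltn (leq_ltn_trans le_m).
Qed.

(** Modulo the ideal, [p] is a reduced form [qR]. If [z^e qR] lies in the ideal, it is a combination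
    of nonreduced power products, which is a relation in the Lefschetz family; freeness forces
    [qR = 0]. *)
Lemma power_full_rank_inj i e :
  mpoly_free (@lefschetz_index n D i e) (fun m => lefschetz_family D F e (bmnm m)) ->
  forall p, p \is i.-homog -> ideal_gen F (sum_vars K n ^+ e * p) -> ideal_gen F p.
Proof.
move=> fr p hp; have [q hq ->] := basis_map_homog_surj hp => Ip.
have lt_i : (i < (i + e).+1)%N by rewrite ltnS leq_addr.
pose qN : {mpoly K[n]} := \sum_(m : 'X_{1..n < (i + e).+1} |
  (mdeg m == i) && in_mono_prefix D n m) q@_m *: 'X_[m].
pose qR : {mpoly K[n]} := \sum_(m : 'X_{1..n < (i + e).+1} |
  (mdeg m == i) && ~~ in_mono_prefix D n m) q@_m *: 'X_[m].
have qE : q = qN + qR.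
  rewrite {1}(homog_expand hq lt_i).
  by rewrite (bigID (fun m : 'X_{1..n < (i + e).+1} => in_mono_prefix D n m)).
have INq : ideal_gen F (basis_map qN).
  by apply/basis_map_ideal/mono_ideal_sumX => m /andP[].
have qRE : basis_map qR = qR.
  rewrite basis_map_sumX; apply: eq_bigr => m /andP[_ mr].
  by rewrite power_basis_reduced.
have hqR : qR \is i.-homog.
  by rewrite rpred_sum // => m /andP[/eqP dm _]; rewrite rpredZ // dhomogX /= dm.
have [r hr rE] := basis_map_homog_surj (homog_sum_varsM e hqR).
have Ir : mono_ideal D n r.
  apply/basis_map_ideal; rewrite -rE -qRE.
  have -> : basis_map qR = basis_map q + (-1) * basis_map qN.
    by rewrite qE linearD /= mulN1r addrAC subrr add0r.
  rewrite mulrDr; apply/ideal_gen_prefix/ideal_prefixD; first exact/ideal_gen_prefix.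
  by apply/ideal_prefixM/ideal_prefixM/ideal_gen_prefix.
rewrite [(e + i)%N]addnC in hr.
have rN : r = \sum_(m : 'X_{1..n < (i + e).+1} |
    (mdeg m == i + e)%N && in_mono_prefix D n m) r@_m *: 'X_[m].
  rewrite {1}(homog_expand hr (ltnSn _)).
  rewrite (bigID (fun m : 'X_{1..n < (i + e).+1} => in_mono_prefix D n m)) /=.
  rewrite [X in _ + X]big1 ?addr0 // => m /andP[_ /Ir->]; exact: scale0r.
pose c (m : 'X_{1..n < (i + e).+1}) := if in_mono_prefix D n m then - r@_m else q@_m.
have c0 : \sum_(m | lefschetz_index D m) c m *: lefschetz_family D F e (bmnm m) = 0.
  rewrite lefschetz_family_sum.
  rewrite [X in _ + _ * X](_ : _ = qR); last first.
    by apply: eq_bigr => m /andP[_ mr]; rewrite /c (negPf mr).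
  rewrite rE rN basis_map_sumX -big_split big1 //= => m /andP[_ mN].
  by rewrite /c mN scaleNr addNr.
have qR0 : qR = 0.
  apply: big1 => m /andP[dm mr]; have := fr c c0 m.
  by rewrite /lefschetz_index /c (negPf mr) => -> //; rewrite scale0r.
by rewrite qE qR0 addr0.
Qed.

Lemma power_full_rank_surj i e :
  mpoly_spans (i + e) (@lefschetz_index n D i e)
    (fun m => lefschetz_family D F e (bmnm m)) ->
  forall q, q \is (i + e)%N.-homog -> exists p, p \is i.-homog /\
    ideal_gen F (q - sum_vars K n ^+ e * p).
Proof.
move=> sp q /sp[c ->]; rewrite lefschetz_family_sum.
set p := (X in _ + _ * X); exists p; split.
  by rewrite rpred_sum // => m /andP[/eqP dm _]; rewrite rpredZ // dhomogX /= dm.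
by rewrite addrK -basis_map_sumX; apply/basis_map_ideal/mono_ideal_sumX => m /andP[].
Qed.

End Transfer.

(** * The generic forms *)

(* [ratr] is only a ring morphism into ordered fields in the library; on
   integral coefficients it agrees with the canonical morphism from [int]. *)
Lemma alg_indep_int (K : fieldType) (I : finType) (x : I -> K) :
  alg_indep_Q x -> forall P : {mpoly int[#|I|]},
  mmap (intr : int -> K) (fun t => x (enum_val t)) P = 0 -> P = 0.
Proof.
move=> indep P P0; apply/eqP; apply/negPn/negP => Pneq0.
pose Q : {mpoly rat[#|I|]} := map_mpoly intr P.
have suppQ : perm_eq (msupp Q) (msupp P) by apply: msupp_map_mpoly; apply: intr_inj.
have Qneq0 : Q != 0.
  apply: contra_neq Pneq0 => Q0; apply/mpolyP => m; apply/eqP.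
  by rewrite mcoeff0 -(intr_eq0 rat) -[_%:~R](mcoeff_map_mpoly intr) [map_mpoly _ _]Q0 mcoeff0.
have /eqP := indep Q Qneq0; apply.
(* [P] and [Q] have the same support, so the two evaluations agree term by term. *)
rewrite -[RHS]P0 /map_mpoly /mmap rmorph_sum /= (perm_big _ suppQ) /=.
apply: eq_bigr => m _; rewrite rmorphM /= mevalC mcoeff_map_mpoly ratr_int.
by rewrite mmap1_id mevalX.
Qed.

Lemma map_homog (S T : comNzRingType) (f : {rmorphism S -> T}) (n d : nat)
    (p : {mpoly S[n]}) : p \is d.-homog -> map_mpoly f p \is d.-homog.
Proof.
move=> hp; apply: homog_coeffP => m md.
by rewrite mcoeff_map_mpoly (dhomog_nemf_coeff hp md) raddf0.
Qed.

Section Generic.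
Variables (n : nat) (m : 'I_n -> nat) (d : forall i : 'I_n, 'I_(m i) -> nat).

Let var := {i : 'I_n & ('I_(m i) * 'I_n)%type}.

(** Each coefficient is an indeterminate of its own over [int], so any choice of coefficients in [K]
    is a ring morphism [specialize]. *)
Definition generic_form (i : 'I_n) : {mpoly {mpoly int[#|{: var}|]}[n]} :=
  \prod_(j < m i) (\sum_(k < n)
    'X_(enum_rank (Tagged (fun i => ('I_(m i) * 'I_n)%type) (j, k)))
      *: 'X_k) ^+ d j.

Definition total_degree (i : 'I_n) := (\sum_(j < m i) d j)%N.

Lemma generic_form_homog i : generic_form i \is (total_degree i).-homog.
Proof.
apply: dhomog_bigprod => j; rewrite -[X in X.-homog]mul1n; apply: dhomogMn.
by rewrite rpred_sum // => k _; rewrite rpredZ // dhomogX /= mdeg1.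
Qed.

Variables (K : fieldType) (x : var -> K).

Definition specialize : {mpoly int[#|{: var}|]} -> K :=
  mmap (intr : int -> K) (fun t => x (enum_val t)).

HB.instance Definition _ := GRing.RMorphism.on specialize.

Lemma specialize_generic_form i :
  map_mpoly specialize (generic_form i) =
  \prod_(j < m i) linform (fun k => x (Tagged _ (j, k))) ^+ d j.
Proof.
rewrite rmorph_prod; apply: eq_bigr => j _; rewrite rmorphXn raddf_sum /=.
congr (_ ^+ _); apply: eq_bigr => k _.
by rewrite map_mpolyZ map_mpolyX /= /specialize mmapX mmap1U enum_rankK.
Qed.

End Generic.

Unset Implicit Arguments.

Theorem theorem4p1 (K : fieldType) (charK : [pchar K] =i pred0) (n : nat)
  (m : 'I_n -> nat) (d : forall i : 'I_n, 'I_(m i) -> nat)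
  (xi : forall i : 'I_n, 'I_(m i) -> 'I_n -> K)
  (m_pos : forall i, (0 < m i)%N)
  (d_pos : forall i j, (0 < d i j)%N)
  (indep : alg_indep_Q
     (fun t : {i : 'I_n & ('I_(m i) * 'I_n)%type} =>
        xi (tag t) (tagged t).1 (tagged t).2)) :
  complete_intersection (ideal_gen (Fgen d xi)) /\
  artinian (ideal_gen (Fgen d xi)) /\
  SLP (ideal_gen (Fgen d xi)).
Proof.
pose D := total_degree d.
have D_pos i : (0 < D i)%N.
  rewrite /D /total_degree (bigD1 (Ordinal (m_pos i))) //=.
  by rewrite ltn_addr.
pose phi := specialize (fun t : {i : 'I_n & ('I_(m i) * 'I_n)%type} =>
        xi (tag t) (tagged t).1 (tagged t).2).
(* The monomial point: the coefficient of [x_k] in [L_ij] becomes 1 if [k = i] and 0 otherwise. *)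
pose psi := specialize (fun t : {i : 'I_n & ('I_(m i) * 'I_n)%type} =>
        ((tagged t).2 == tag t)%:R : K).
(* Algebraic independence makes [phi] injective. *)
have phi_psi s : phi s = 0 -> psi s = 0.
  by move=> /(alg_indep_int indep)->; apply: rmorph0.
have phiF i : map_mpoly phi (generic_form d i) = Fgen d xi i.
  exact: specialize_generic_form.
have psiF i : map_mpoly psi (generic_form d i) = 'X_i ^+ D i.
  rewrite specialize_generic_form /D /total_degree expr_sum.
  apply: eq_bigr => j _; congr (_ ^+ _); rewrite /linform (bigD1 i) //= eqxx scale1r.
  by rewrite big1 ?addr0 // => k /negPf->; rewrite scale0r.
have homF (f : {rmorphism _ -> K}) i : map_mpoly f (generic_form d i) \is (D i).-homog.
  exact/map_homog/generic_form_homog.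
have hF i : Fgen d xi i \is (D i).-homog by rewrite -phiF; apply: homF.
have hX i : ('X_i : {mpoly K[n]}) ^+ D i \is (D i).-homog by rewrite -psiF; apply: homF.
have pbE (f : {rmorphism _ -> K}) G : (fun i => map_mpoly f (generic_form d i)) =1 G ->
    forall l, map_mpoly f (power_basis D (generic_form d) l) = power_basis D G l.
  by move=> fG l; rewrite map_power_basis; apply: eq_power_basis.
have lfE (f : {rmorphism _ -> K}) G : (fun i => map_mpoly f (generic_form d i)) =1 G ->
    forall e l, map_mpoly f (lefschetz_family D (generic_form d) e l) = lefschetz_family D G e l.
  by move=> fG e l; rewrite map_lefschetz_family /lefschetz_family (eq_power_basis _ fG).
have pb_homog (f : {rmorphism _ -> K}) e (l : 'X_{1..n < e.+1}) : mdeg l == e ->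
    map_mpoly f (power_basis D (generic_form d) l) \is e.-homog.
  by move=> /eqP le; have := power_basis_homog l (homF f); rewrite le map_power_basis.
have lf_homog (f : {rmorphism _ -> K}) i e (l : 'X_{1..n < (i + e).+1}) : lefschetz_index D l ->
    map_mpoly f (lefschetz_family D (generic_form d) e l) \is (i + e)%N.-homog.
  by rewrite map_lefschetz_family; apply: lefschetz_family_homog.
have basis_free e : mpoly_free (fun l : 'X_{1..n < e.+1} => mdeg l == e)
    (fun l => power_basis D (Fgen d xi) l).
  apply: (specialization_free phi_psi (fun f => pb_homog f e)
           (pbE _ _ psiF) (pbE _ _ phiF)).
  exact: mono_power_basis_free.
have basis_spans e : mpoly_spans e (fun l : 'X_{1..n < e.+1} => mdeg l == e)
    (fun l => power_basis D (Fgen d xi) l).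
  apply: (specialization_spans phi_psi (fun f => pb_homog f e)
           (pbE _ _ psiF) (pbE _ _ phiF)).
  exact: mono_power_basis_spans.
split; first by exists n, (Fgen d xi); split=> //; apply: power_regular basis_free basis_spans.
split; first exact: power_artinian basis_free basis_spans.
exists (socle_degree D); split; first exact: power_top_degree basis_free basis_spans.
exists (sum_vars K n); split; first exact: sum_vars_homog.
(* Degrees [i] and [i + e] are compared through their midpoint: up to half the socle degree
   multiplication is injective, beyond it surjective. *)
move=> e i _ _ _; have [le_c|/ltnW le_c] := leqP (2 * i + e) (socle_degree D).
  left; apply: power_full_rank_inj basis_free basis_spans _ _ _ => //.
  apply: (specialization_free phi_psi (fun f => lf_homog f i e)
           (lfE _ _ psiF e) (lfE _ _ phiF e)).
  exact: mono_lefschetz_family_free.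
right=> q; apply: (power_full_rank_surj D_pos hF basis_free basis_spans).
apply: (specialization_spans phi_psi (fun f => lf_homog f i e)
         (lfE _ _ psiF e) (lfE _ _ phiF e)).
exact: mono_lefschetz_family_spans.
Qed.
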